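(* The Double-Index Formulation (DIF) provides a tighter continuous relaxation than the (linearized) Single-Index Formulation (SIF) of the problem DFLP-CCD. That is, for every instance, the optimal value of the continuous relaxation of the DIF (a maximization problem) is less than or equal to the optimal value of the continuous relaxation of the SIF, and there exists an instance for which this inequality is strict.
   Context: **Instance.** Finite nonempty sets $\mathcal{I}$ (locations), $\mathcal{J}$ (customers), time periods $\mathcal{T}=\{1,\ldots,T\}$, with $\mathcal{T}^S=\{0\}\cup\mathcal{T}$ and $\mathcal{T}^F=\mathcal{T}\cup\{T+1\}$; rewards $r_i\ge 0$ for $i\in\mathcal{I}$; spawning demands $d^t_j\ge 0$ for $j\in\mathcal{J},t\in\mathcal{T}$; for each customer $j$ a strict total order (ranking) $\succ_j$ on $\mathcal{I}\cup\{0\}$, where $0$ denotes ''no service''; $a_{ij}=1$ if $i\succ_j 0$ and $a_{ij}=0$ otherwise. The nonempty set $\mathcal{Y}$ of feasible binary vectors $\boldsymbol y=(y^t_i)$ is described by linear constraints and the cost $f(\boldsymbol y)$ is a linear function (e.g. $\mathcal{Y}$ given by $\sum_{i\in\mathcal{I}}y^t_i\le h$ for all $t$, with $h$ a positive integer, and $f=0$). For $\ell<t$ put $D^{\ell t}_j=\sum_{s\in\mathcal{T}:\,\ell<s\le t}d^s_j$ and $G^{\ell t}_{ij}=r_iD^{\ell t}_j$. **DIF.** Variables $y^t_i\in\{0,1\}$ ($i\in\mathcal{I},t\in\mathcal{T}$) and $x^{\ell t}_{ij}\in\{0,1\}$ ($i\in\mathcal{I},j\in\mathcal{J},\ell\in\mathcal{T}^S,t\in\mathcal{T}^F,\ell<t$).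 Maximize $$\sum_{t\in\mathcal{T}}\sum_{\ell\in\mathcal{T}^S:\ell<t}\sum_{i\in\mathcal{I}}\sum_{j\in\mathcal{J}}G^{\ell t}_{ij}x^{\ell t}_{ij}-f(\boldsymbol y)$$ subject to $\boldsymbol y\in\mathcal{Y}$ and: - $\sum_{\ell\in\mathcal{T}^S:\ell<t}x^{\ell t}_{ij}\le a_{ij}y^t_i$ for all $i\in\mathcal{I},j\in\mathcal{J},t\in\mathcal{T}$; - $\sum_{\ell\in\mathcal{T}^S:\ell<t}\sum_{k\in\mathcal{I}}x^{\ell t}_{kj}\ge a_{ij}y^t_i$ for all $i\in\mathcal{I},j\in\mathcal{J},t\in\mathcal{T}$; - $a_{ij}y^t_i+\sum_{\ell\in\mathcal{T}^S:\ell<t}\sum_{k\in\mathcal{I}:i\succ_jk}x^{\ell t}_{kj}\le a_{ij}$ for all $i\in\mathcal{I},j\in\mathcal{J},t\in\mathcal{T}$; - $\sum_{s\in\mathcal{T}^F:s>t}\sum_{i\in\mathcal{I}}x^{ts}_{ij}-\sum_{s\in\mathcal{T}^S:s<t}\sum_{i\in\mathcal{I}}x^{st}_{ij}=0$ for all $j\in\mathcal{J},t\in\mathcal{T}$; - $\sum_{s\in\mathcal{T}^F}\sum_{i\in\mathcal{I}}x^{0s}_{ij}=1$ for all $j\in\mathcal{J}$. **SIF (linearized).** Variables $y^t_i\in\{0,1\}$, $x^t_{ij}\in\{0,1\}$, $w^t_{ij}\ge0$, $c^t_j\ge0$ ($i\in\mathcal{I},j\in\mathcal{J},t\in\mathcal{T}$),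 $u^t_j\ge0$ ($j\in\mathcal{J},t\in\mathcal{T}^S$). The $M^t_j$ are sufficiently large constants, meaning $M^t_j\ge D^{0t}_j$ (e.g. $M^t_j=D^{0t}_j$). Maximize $\sum_{t\in\mathcal{T}}\sum_{i\in\mathcal{I}}\sum_{j\in\mathcal{J}}r_iw^t_{ij}-f(\boldsymbol y)$ subject to $\boldsymbol y\in\mathcal{Y}$ and, for all $i\in\mathcal{I},j\in\mathcal{J},t\in\mathcal{T}$: - $x^t_{ij}\le a_{ij}y^t_i$; $\ \sum_{k\in\mathcal{I}}x^t_{kj}\ge a_{ij}y^t_i$; $\ a_{ij}y^t_i+\sum_{k\in\mathcal{I}:i\succ_jk}x^t_{kj}\le a_{ij}$; - $u^0_j=0$; $\ c^t_j=u^{t-1}_j+d^t_j$; $\ u^t_j=c^t_j-\sum_{i\in\mathcal{I}}w^t_{ij}$; - $w^t_{ij}\le M^t_jx^t_{ij}$; $\ w^t_{ij}\le c^t_j+M^t_j(1-x^t_{ij})$; $\ w^t_{ij}\ge-M^t_jx^t_{ij}$; $\ w^t_{ij}\ge c^t_j-M^t_j(1-x^t_{ij})$. **Continuous relaxation.** All conditions ''$\in\{0,1\}$'' are replaced by ''$\in[0,1]$'', and $\boldsymbol y\in\mathcal{Y}$ by the linear constraints describing $\mathcal{Y}$. *)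

(* Defs.v *)
From HB Require Import structures.
From mathcomp Require Import all_boot all_order all_algebra.
From mathcomp Require Import all_classical all_reals all_analysis.

Set Implicit Arguments.
Unset Strict Implicit.
Unset Printing Implicit Defensive.

Import Order.TTheory GRing.Theory Num.Theory.

Local Open Scope classical_set_scope.
Local Open Scope ring_scope.

(* With T the horizon, periods are plain natural numbers: 1 <= t <= T for the
   set of periods, with 0 added for its "start" extension and T.+1 for its
   "final" extension.  Data and variables are total functions of the period;
   every sum and every constraint below only reads them within these ranges, so
   values outside are irrelevant. *)

Definition strict_total_order (U : eqType) (r : rel U) : Prop :=
  [/\ irreflexive r, transitive r & forall a b : U, a != b -> r a b || r b a].

Definition binary (R : realType) : set R := [set 0; 1].
Definition unit_interval (R : realType) : set R := `[0, 1].

(* Integrality domains are a parameter of the formulations: [binary] gives the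
   integer programs and [unit_interval] their continuous relaxations.

   [rank j a b] means that customer j strictly prefers a to b, where [None] is
   the "no service" option.  The feasible set of location vectors is
   {y binary | sum_(i, t) ycoef c i t * y i t <= yrhs c for all c}; an equality
   constraint is a pair of inequalities.  The cost f is the linear function with
   coefficients [cost]. *)
Record instance (R : realType) := Instance {
  loc : finType;
  cust : finType;
  horizon : nat;
  reward : loc -> R;
  demand : cust -> nat -> R;
  rank : cust -> rel (option loc);
  ncons : nat;
  ycoef : 'I_ncons -> loc -> nat -> R;
  yrhs : 'I_ncons -> R;
  cost : loc -> nat -> R;
  loc_nonempty : (0 < #|loc|)%N;
  cust_nonempty : (0 < #|cust|)%N;
  horizon_gt0 : (0 < horizon)%N;
  reward_ge0 : forall i, 0 <= reward i;
  demand_ge0 : forall j t, (1 <= t <= horizon)%N -> 0 <= demand j t;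
  rank_order : forall j, strict_total_order (rank j);
  Y_nonempty : exists y : loc -> nat -> R,
    (forall i t, (1 <= t <= horizon)%N -> binary (y i t)) /\
    (forall c, \sum_(1 <= t < horizon.+1) \sum_(i : loc) ycoef c i t * y i t
               <= yrhs c)
}.

Section Formulations.
Variables (R : realType) (P : instance R).
Local Notation I := (loc P).
Local Notation J := (cust P).
Local Notation T := (horizon P).

Definition acc (i : I) (j : J) : R := (rank j (Some i) None)%:R.

Definition prefers (j : J) (i k : I) : bool := rank j (Some i) (Some k).

Definition cumD (j : J) (l t : nat) : R :=
  \sum_(1 <= s < T.+1 | (l < s <= t)%N) demand j s.

Definition gain (i : I) (j : J) (l t : nat) : R := reward i * cumD j l t.

Definition costf (y : I -> nat -> R) : R :=
  \sum_(1 <= t < T.+1) \sum_(i : I) cost i t * y i t.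

Definition inY (dom : set R) (y : I -> nat -> R) : Prop :=
  (forall i t, (1 <= t <= T)%N -> dom (y i t)) /\
  (forall c, \sum_(1 <= t < T.+1) \sum_(i : I) ycoef c i t * y i t
             <= yrhs c).

(* [x i j l t] is the variable x^{l t}_{i j}. *)
Record DIF_feasible (dom : set R) (y : I -> nat -> R)
    (x : I -> J -> nat -> nat -> R) : Prop := {
  DIF_y : inY dom y;
  DIF_x : forall i j l t, (l < t <= T.+1)%N -> dom (x i j l t);
  DIF_open : forall i j t, (1 <= t <= T)%N ->
    \sum_(0 <= l < t) x i j l t <= acc i j * y i t;
  DIF_capture : forall i j t, (1 <= t <= T)%N ->
    acc i j * y i t <= \sum_(0 <= l < t) \sum_(k : I) x k j l t;
  DIF_pref : forall i j t, (1 <= t <= T)%N ->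
    acc i j * y i t
      + \sum_(0 <= l < t) \sum_(k : I | prefers j i k) x k j l t <= acc i j;
  DIF_flow : forall j t, (1 <= t <= T)%N ->
    \sum_(t.+1 <= s < T.+2) \sum_(i : I) x i j t s
      - \sum_(0 <= s < t) \sum_(i : I) x i j s t = 0;
  DIF_source : forall j, \sum_(1 <= s < T.+2) \sum_(i : I) x i j 0%N s = 1
}.

Definition DIF_objective (y : I -> nat -> R) (x : I -> J -> nat -> nat -> R) :
    R :=
  \sum_(1 <= t < T.+1) \sum_(0 <= l < t) \sum_(i : I) \sum_(j : J)
    gain i j l t * x i j l t - costf y.

Definition DIF_value (dom : set R) : \bar R :=
  ereal_sup [set v | exists y x,
    DIF_feasible dom y x /\ v = (DIF_objective y x)%:E].

Definition bigM_valid (M : J -> nat -> R) : Prop :=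
  forall j t, (1 <= t <= T)%N -> cumD j 0 t <= M j t.

Record SIF_feasible (M : J -> nat -> R) (dom : set R) (y : I -> nat -> R)
    (x w : I -> J -> nat -> R) (c u : J -> nat -> R) : Prop := {
  SIF_y : inY dom y;
  SIF_x : forall i j t, (1 <= t <= T)%N -> dom (x i j t);
  SIF_w_ge0 : forall i j t, (1 <= t <= T)%N -> 0 <= w i j t;
  SIF_c_ge0 : forall j t, (1 <= t <= T)%N -> 0 <= c j t;
  SIF_u_ge0 : forall j t, (t <= T)%N -> 0 <= u j t;
  SIF_open : forall i j t, (1 <= t <= T)%N -> x i j t <= acc i j * y i t;
  SIF_capture : forall i j t, (1 <= t <= T)%N ->
    acc i j * y i t <= \sum_(k : I) x k j t;
  SIF_pref : forall i j t, (1 <= t <= T)%N ->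
    acc i j * y i t + \sum_(k : I | prefers j i k) x k j t <= acc i j;
  SIF_u0 : forall j, u j 0%N = 0;
  SIF_c : forall j t, (1 <= t <= T)%N -> c j t = u j t.-1 + demand j t;
  SIF_u : forall j t, (1 <= t <= T)%N -> u j t = c j t - \sum_(i : I) w i j t;
  SIF_w_ub : forall i j t, (1 <= t <= T)%N -> w i j t <= M j t * x i j t;
  SIF_w_ub_c : forall i j t, (1 <= t <= T)%N ->
    w i j t <= c j t + M j t * (1 - x i j t);
  SIF_w_lb : forall i j t, (1 <= t <= T)%N -> - (M j t * x i j t) <= w i j t;
  SIF_w_lb_c : forall i j t, (1 <= t <= T)%N ->
    c j t - M j t * (1 - x i j t) <= w i j t
}.

Definition SIF_objective (y : I -> nat -> R) (w : I -> J -> nat -> R) : R :=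
  \sum_(1 <= t < T.+1) \sum_(i : I) \sum_(j : J) reward i * w i j t - costf y.

Definition SIF_value (M : J -> nat -> R) (dom : set R) : \bar R :=
  ereal_sup [set v | exists y x w c u,
    SIF_feasible M dom y x w c u /\ v = (SIF_objective y w)%:E].

Definition DIF_relaxation_value : \bar R := DIF_value (@unit_interval R).

Definition SIF_relaxation_value (M : J -> nat -> R) : \bar R :=
  SIF_value M (@unit_interval R).

End Formulations.

(* Main.v *)
Require Import Defs.
From mathcomp Require Import all_boot all_order all_algebra.
From mathcomp Require Import all_classical all_reals all_analysis.
From mathcomp Require Import lra.

Set Implicit Arguments.
Unset Strict Implicit.
Unset Printing Implicit Defensive.

Import Order.TTheory GRing.Theory Num.Theory.

(** In the double-index formulation, [x i j l t] moves one unit of flow of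
    customer [j] through the periods [0, 1, ..., T.+1]: the part going from [l]
    to [t] is the share of the demand spawned in the periods [l.+1, ..., t]
    that is served at [t].

    For the inequality of the relaxations, any relaxed double-index point gives
    a relaxed single-index point with the same [y] and the same objective:
    [x i j t] and [w i j t] are the sums over [l < t] of [x i j l t] and of
    [cumD j l t * x i j l t].  The unserved demand left by this choice has a
    closed form, the sum over arcs [l -> s] with [l <= t < s] of [cumD j l t]
    times their flow, which makes its sign visible.  The recursion between [c]
    and [u] then says that the newly spawned demand is counted exactly once,
    because the arcs that cross any period carry a total flow of 1
    ([crossing_flow]).  The last big-M constraint compares two quantities: [c]
    minus [w i] is the demand carried by the crossing arcs other than those
    that serve the customer at [i], and these carry a flow [1 - x i] with at
    most [cumD j 0 t <= M j t] on each.

    For strictness, take one location, one customer, two periods of demand 1,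
    reward 1, and cost 1 for opening in the second period.  Write [x01], [x02],
    [x12] for the flows.  A relaxed double-index point has value at most
    [(x01 + 2 * x02 + x12) - (x02 + x12) = x01 + x02 <= 1], since serving in
    period 2 requires opening at that level.  In the single-index relaxation,
    [M j 2 >= 2] lets a half-open facility serve in period 2 the whole unit of
    demand that is present after period 1 was fully served, so
    all demand is collected at cost [1 / 2] and the value is at least
    [3 / 2]. *)

(** * Cumulated demand *)

Section CumulatedDemand.
Local Open Scope ring_scope.
Variables (R : realType) (P : instance R).
Implicit Types (j : cust P) (l t : nat).

Lemma cumDE j l t : (t <= horizon P)%N ->
  cumD j l t = \sum_(l.+1 <= s < t.+1) demand j s.
Proof.
move=> tT; rewrite /cumD (big_nat_widenl l.+1 1) //.
by rewrite (big_nat_widen 1 t.+1 (horizon P).+1).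
Qed.

Lemma cumD_ge0 j l t : (t <= horizon P)%N -> 0 <= cumD j l t.
Proof.
move=> tT; rewrite /cumD big_seq_cond; apply: sumr_ge0 => s.
by rewrite mem_index_iota ltnS => /andP[sT _]; exact: demand_ge0.
Qed.

Lemma cumD_diag j t : (t <= horizon P)%N -> cumD j t t = 0.
Proof. by move=> tT; rewrite cumDE // big_geq. Qed.

Lemma cumDS j l t : (l <= t)%N -> (t < horizon P)%N ->
  cumD j l t.+1 = cumD j l t + demand j t.+1.
Proof. by move=> lt tT; rewrite !cumDE ?(ltnW tT) // big_nat_recr. Qed.

Lemma cumD_le0 j l t : (t <= horizon P)%N -> cumD j l t <= cumD j 0 t.
Proof.
move=> tT; rewrite /cumD big_mkcond [leRHS]big_mkcond /=.
apply: ler_sum_nat => s /andP[s0 sT]; rewrite s0 /=.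
have d0 : 0 <= demand j s by apply: demand_ge0; rewrite s0.
by case: (l < s)%N => //=; case: ifP.
Qed.

End CumulatedDemand.

(** * Unit flows on time arcs *)

Section UnitFlow.
Local Open Scope ring_scope.
Variables (R : realType) (T : nat) (X : nat -> nat -> R).

Definition outflow (l t : nat) : R := \sum_(t <= s < T.+2) X l s.

Lemma outflow_recl l t : (t <= T.+1)%N -> outflow l t = X l t + outflow l t.+1.
Proof. by move=> tT; rewrite /outflow big_ltn. Qed.

Hypothesis source : outflow 0 1 = 1.
Hypothesis conservation : forall t, (1 <= t <= T)%N ->
  outflow t t.+1 = \sum_(0 <= s < t) X s t.

(** From one period to the next, the crossing arcs lose those that end at
    the first one and gain those that start at it; conservation makes the two
    equal. *)
Lemma crossing_flow t : (t <= T)%N -> \sum_(0 <= l < t.+1) outflow l t.+1 = 1.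
Proof.
elim: t => [_|t IH tT]; first by rewrite big_nat1.
rewrite big_nat_recr //= conservation // -big_split /= -(IH (ltnW tT)).
by apply: eq_bigr => l _; rewrite [RHS]outflow_recl ?(leqW tT) // addrC.
Qed.

End UnitFlow.

(** * From double-index to single-index points *)

Section Aggregation.
Local Open Scope ring_scope.
Variables (R : realType) (P : instance R).
Local Notation I := (loc P).
Local Notation J := (cust P).
Local Notation T := (horizon P).
Variables (y : I -> nat -> R) (x : I -> J -> nat -> nat -> R).
Hypothesis Dxy : DIF_feasible (@unit_interval R) y x.

Definition arc_flow (j : J) (l s : nat) : R := \sum_(i : I) x i j l s.
Local Notation out j := (outflow T (arc_flow j)).

Definition agg_x (i : I) (j : J) (t : nat) : R := \sum_(0 <= l < t) x i j l t.

Definition agg_w (i : I) (j : J) (t : nat) : R :=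
  \sum_(0 <= l < t) cumD j l t * x i j l t.

(** Closed form of [cumD j 0 t] minus all that was served up to [t]. *)
Definition agg_u (j : J) (t : nat) : R :=
  \sum_(0 <= l < t.+1) cumD j l t * out j l t.+1.

Definition agg_c (j : J) (t : nat) : R := agg_u j t.-1 + demand j t.

Lemma x_ge0 i j l t : (l < t <= T.+1)%N -> 0 <= x i j l t.
Proof.
move=> /(DIF_x Dxy i j); rewrite /unit_interval /= in_itv /=.
by case/andP.
Qed.

Lemma y_le1 i t : (1 <= t <= T)%N -> y i t <= 1.
Proof.
move=> /((DIF_y Dxy).1 i); rewrite /unit_interval /= in_itv /=.
by case/andP.
Qed.

Lemma arc_flow_ge0 j l s : (l < s <= T.+1)%N -> 0 <= arc_flow j l s.
Proof. by move=> ls; apply: sumr_ge0 => i _; exact: x_ge0. Qed.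

Lemma outflow_ge0 j l t : (l < t)%N -> 0 <= out j l t.
Proof.
move=> lt; rewrite /outflow big_seq; apply: sumr_ge0 => s.
rewrite mem_index_iota ltnS => /andP[ts sT]; apply: arc_flow_ge0.
by rewrite sT (leq_trans lt ts).
Qed.

Lemma x_le_outflow i j l t : (l < t <= T.+1)%N -> x i j l t <= out j l t.
Proof.
move=> /andP[lt tT]; rewrite outflow_recl // /arc_flow (bigD1 i) //= -addrA.
rewrite lerDl addr_ge0 ?outflow_ge0 ?leqW //.
by apply: sumr_ge0 => k _; apply: x_ge0; rewrite lt.
Qed.

Lemma sum_outflow j t : (1 <= t <= T)%N -> \sum_(0 <= l < t) out j l t = 1.
Proof.
case: t => // t tT; apply: crossing_flow => [|s sT|]; last exact: ltnW.
- exact: (DIF_source Dxy).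
- by apply/eqP; rewrite -subr_eq0; apply/eqP; exact: (DIF_flow Dxy).
Qed.

Lemma agg_cE j t : (1 <= t <= T)%N ->
  agg_c j t = \sum_(0 <= l < t) cumD j l t * out j l t.
Proof.
move=> tT; rewrite /agg_c -[demand j t]mulr1 -(sum_outflow j tT) mulr_sumr.
case: t tT => // t tT; rewrite /agg_u -big_split /=; apply: eq_big_nat => l lt.
by rewrite -mulrDl cumDS.
Qed.

Lemma agg_uE j t : (1 <= t <= T)%N ->
  agg_u j t = agg_c j t - \sum_(i : I) agg_w i j t.
Proof.
move=> tT; have /andP[_ t_leT] := tT.
rewrite agg_cE // /agg_w exchange_big /= /agg_u big_nat_recr //=.
rewrite cumD_diag // mul0r addr0 -sumrB; apply: eq_bigr => l _.
rewrite (outflow_recl _ _ (leqW t_leT)) -mulr_sumr -mulrBr.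
by rewrite /arc_flow addrC addKr.
Qed.

Lemma agg_x_ge0 i j t : (1 <= t <= T)%N -> 0 <= agg_x i j t.
Proof.
move=> /andP[_ tT]; rewrite /agg_x big_seq; apply: sumr_ge0 => l.
by rewrite mem_index_iota => /andP[_ lt]; apply: x_ge0; rewrite lt leqW.
Qed.

Lemma agg_x_le1 i j t : (1 <= t <= T)%N -> agg_x i j t <= 1.
Proof.
move=> tT; apply: (le_trans (DIF_open Dxy i j tT)).
rewrite /acc; case: (rank _ _ _); rewrite ?mul1r ?mul0r //.
exact: y_le1.
Qed.

Lemma agg_w_ge0 i j t : (1 <= t <= T)%N -> 0 <= agg_w i j t.
Proof.
move=> /andP[_ tT]; rewrite /agg_w big_seq; apply: sumr_ge0 => l.
rewrite mem_index_iota => /andP[_ lt]; apply: mulr_ge0; first exact: cumD_ge0.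
by apply: x_ge0; rewrite lt leqW.
Qed.

Lemma agg_u_ge0 j t : (t <= T)%N -> 0 <= agg_u j t.
Proof.
move=> tT; rewrite /agg_u big_seq; apply: sumr_ge0 => l.
rewrite mem_index_iota => /andP[_ lt].
by apply: mulr_ge0; [exact: cumD_ge0 | exact: outflow_ge0].
Qed.

Lemma agg_c_ge0 j t : (1 <= t <= T)%N -> 0 <= agg_c j t.
Proof.
move=> /[dup] tT /andP[_ t_leT]; apply: addr_ge0; last exact: demand_ge0.
by apply: agg_u_ge0; rewrite (leq_trans (leq_pred t)).
Qed.

Lemma agg_w_le_c i j t : (1 <= t <= T)%N -> agg_w i j t <= agg_c j t.
Proof.
move=> /[dup] tT /andP[_ t_leT]; rewrite agg_cE // /agg_w.
apply: ler_sum_nat => l /andP[_ lt]; apply: ler_wpM2l; first exact: cumD_ge0.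
by apply: x_le_outflow; rewrite lt leqW.
Qed.

Variable M : J -> nat -> R.
Hypothesis validM : bigM_valid M.

Lemma cumD_leM j l t : (1 <= t <= T)%N -> cumD j l t <= M j t.
Proof.
move=> tT; apply: le_trans (validM j tT).
by apply: cumD_le0; case/andP: tT.
Qed.

Lemma bigM_ge0 j t : (1 <= t <= T)%N -> 0 <= M j t.
Proof.
by move=> tT; apply: le_trans (cumD_leM j 0 tT); apply: cumD_ge0; case/andP: tT.
Qed.

Lemma agg_w_leM i j t : (1 <= t <= T)%N -> agg_w i j t <= M j t * agg_x i j t.
Proof.
move=> /[dup] tT /andP[_ t_leT]; rewrite /agg_w /agg_x mulr_sumr.
apply: ler_sum_nat => l /andP[_ lt]; apply: ler_wpM2r; last exact: cumD_leM.
by apply: x_ge0; rewrite lt leqW.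
Qed.

(** The difference of [agg_c] and [agg_w i] is carried by the crossing arcs that
    do not serve at [i] in period [t], whose total flow is [1 - agg_x i]. *)
Lemma agg_c_sub_le i j t : (1 <= t <= T)%N ->
  agg_c j t - M j t * (1 - agg_x i j t) <= agg_w i j t.
Proof.
move=> /[dup] tT /andP[_ t_leT]; rewrite lerBlDr -lerBlDl.
rewrite agg_cE // -(sum_outflow j tT) /agg_w /agg_x -!sumrB mulr_sumr.
apply: ler_sum_nat => l /andP[_ lt]; rewrite -mulrBr; apply: ler_wpM2r.
  by rewrite subr_ge0 x_le_outflow // lt leqW.
exact: cumD_leM.
Qed.

Lemma agg_feasible :
  SIF_feasible M (@unit_interval R) y agg_x agg_w agg_c agg_u.
Proof.
split=> //; first exact: (DIF_y Dxy).
- move=> i j t tT; rewrite /unit_interval /= in_itv /=.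
  by rewrite agg_x_ge0 // agg_x_le1.
- exact: agg_w_ge0.
- exact: agg_c_ge0.
- exact: agg_u_ge0.
- exact: (DIF_open Dxy).
- by move=> i j t tT; rewrite exchange_big /=; exact: (DIF_capture Dxy).
- by move=> i j t tT; rewrite exchange_big /=; exact: (DIF_pref Dxy).
- by move=> j; rewrite /agg_u big_nat1 cumD_diag // mul0r.
- exact: agg_uE.
- exact: agg_w_leM.
- move=> i j t tT; apply: (le_trans (agg_w_le_c i j tT)).
  by rewrite lerDl mulr_ge0 ?bigM_ge0 // subr_ge0 agg_x_le1.
- move=> i j t tT; apply: (le_trans _ (agg_w_ge0 i j tT)).
  by rewrite oppr_le0 mulr_ge0 ?bigM_ge0 ?agg_x_ge0.
- exact: agg_c_sub_le.
Qed.

Lemma agg_objective : SIF_objective y agg_w = DIF_objective y x.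
Proof.
congr (_ - _); apply: eq_bigr => t _; rewrite [RHS]exchange_big /=.
apply: eq_bigr => i _; rewrite [RHS]exchange_big /=; apply: eq_bigr => j _.
by rewrite mulr_sumr; apply: eq_bigr => l _; rewrite mulrA.
Qed.

End Aggregation.

Lemma DIF_relaxation_le (R : realType) (P : instance R)
    (M : cust P -> nat -> R) : bigM_valid M ->
  (DIF_relaxation_value P <= SIF_relaxation_value M)%E.
Proof.
move=> validM; apply: ge_ereal_sup => _ [y [x [Dxy ->]]].
apply: ereal_sup_ubound; exists y, (agg_x x), (agg_w x).
exists (agg_c x), (agg_u x); split; first exact: agg_feasible.
by rewrite agg_objective.
Qed.

(** * An instance with a gap *)

Section GapInstance.
Local Open Scope ring_scope.
Variable R : realType.

Definition gap_rank (_ : unit) : rel (option unit) := fun a b => a && ~~ b.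

Lemma gap_rank_order j : strict_total_order (gap_rank j).
Proof. by split=> [[[]|]|[[]|] [[]|] [[]|]|[[]|] [[]|]]. Qed.

Lemma gap_Y_nonempty : exists y : unit -> nat -> R,
  (forall i t, (1 <= t <= 2)%N -> binary (y i t)) /\
  (forall c : 'I_0, \sum_(1 <= t < 3) \sum_(i : unit) 0 * y i t <= 0 :> R).
Proof. by exists (fun _ _ => 0); split=> [i t _|[]//]; left. Qed.

Definition gap_instance : instance R :=
  @Instance R unit unit 2 (fun _ => 1) (fun _ _ => 1) gap_rank
    0 (fun _ _ _ => 0) (fun _ => 0) (fun _ t => (t == 2%N)%:R)
    (eq_leq (esym card_unit)) (eq_leq (esym card_unit)) isT
    (fun _ => ler01) (fun _ _ _ => ler01) gap_rank_order gap_Y_nonempty.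

Lemma sum_unit (F : unit -> R) : \sum_(i : unit) F i = F tt.
Proof. by rewrite (big_pred1 tt) // => -[]. Qed.

Lemma sum_gap_prefers (F : unit -> R) :
  \sum_(k : unit | @prefers R gap_instance tt tt k) F k = 0.
Proof. by rewrite big_pred0 // => -[]. Qed.

Lemma gap_acc : @acc R gap_instance tt tt = 1.
Proof. by []. Qed.

Lemma gap_cumD l t : (t <= 2)%N -> @cumD R gap_instance tt l t = (t - l)%:R.
Proof.
by move=> t2; rewrite cumDE //= sumr_const_nat subSS.
Qed.

Lemma sum_nat2 m (F : nat -> R) : \sum_(m <= t < m.+2) F t = F m + F m.+1.
Proof. by rewrite big_nat_recr ?big_nat1. Qed.

Lemma sum_nat3 m (F : nat -> R) :
  \sum_(m <= t < m.+3) F t = F m + F m.+1 + F m.+2.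
Proof. by rewrite big_nat_recr ?sum_nat2 // leqW. Qed.

Definition sumE := (big_nat1, sum_nat2, sum_nat3, sum_unit, sum_gap_prefers).

(** Net of the opening cost the value is at most [x01 + x02], which the source
    equation makes equal to [1 - x03]. *)
Lemma gap_DIF_le1 : (DIF_relaxation_value gap_instance <= 1%:E)%E.
Proof.
apply: ge_ereal_sup => _ [y [x [Dxy ->]]]; rewrite lee_fin.
have x03 : 0 <= x tt tt 0%N 3%N by exact: (x_ge0 Dxy).
have src := DIF_source Dxy tt.
have open2 := DIF_open Dxy tt tt (isT : (1 <= 2 <= 2)%N).
move: src open2; rewrite /DIF_objective /costf /gain gap_acc /= !sumE /=.
rewrite !gap_cumD // !subn0 subSnn => src open2; lra.
Qed.

(** The witness serves one unit in each period, with the facility half open in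
    period 2.  There [x = 1 / 2] and [M j 2 >= 2] make both upper bounds on [w]
    at least 1 and its lower bounds at most 0. *)
Lemma gap_SIF_ge (M : cust gap_instance -> nat -> R) : bigM_valid M ->
  ((3 / 2)%:E <= SIF_relaxation_value M)%E.
Proof.
move=> validM.
pose y (_ : unit) (t : nat) : R := if t == 1%N then 1 else 2^-1.
pose w (_ _ : unit) (_ : nat) : R := 1.
pose c (_ : unit) (_ : nat) : R := 1.
have M1 : 1 <= M tt 1%N.
  by move: (validM tt 1%N isT); rewrite gap_cumD.
have M2 : 2 <= M tt 2%N.
  by move: (validM tt 2%N isT); rewrite gap_cumD.
have tP t : (1 <= t <= 2)%N -> t = 1%N \/ t = 2%N.
  by case: t => [|[|[|]]] //; [left | right].
apply: ereal_sup_ubound; exists y, (fun i _ => y i), w, c, (fun _ _ => 0).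
split; last first.
  congr EFin; rewrite /SIF_objective /costf /= !sumE /y /w /=; lra.
split=> //; rewrite /y /w /c.
- split=> [i t|[]//]; rewrite /unit_interval /= in_itv /= => /tP[]->/=; lra.
- move=> i j t; rewrite /unit_interval /= in_itv /= => /tP[]->/=; lra.
- by move=> [] [] t _; rewrite gap_acc mul1r lexx.
- by move=> [] [] t _; rewrite gap_acc mul1r /= sum_unit lexx.
- by move=> [] [] t /tP[]->; rewrite gap_acc mul1r sum_gap_prefers /=; lra.
- by move=> [] t _; rewrite add0r.
- by move=> [] t _; rewrite /= sum_unit subrr.
- move=> [] [] t /tP[]->/=; lra.
- move=> [] [] t /tP[]->/=; lra.
- move=> [] [] t /tP[]->/=; lra.
- move=> [] [] t /tP[]->/=; lra.
Qed.

End GapInstance.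

Local Open Scope ereal_scope.

Theorem theorem1 (R : realType) :
  (forall (P : instance R) (M : cust P -> nat -> R), bigM_valid M ->
     DIF_relaxation_value P <= SIF_relaxation_value M) /\
  (exists P : instance R, forall M : cust P -> nat -> R, bigM_valid M ->
     DIF_relaxation_value P < SIF_relaxation_value M).
Proof.
split=> [P M|]; first exact: DIF_relaxation_le.
exists (gap_instance R) => M validM.
apply: le_lt_trans (gap_DIF_le1 R) _; apply: lt_le_trans (gap_SIF_ge validM).
by rewrite lte_fin; lra.
Qed.
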